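(* For all $n\geq1$, $$\sum_{i=1}^{n}B_{i}^{neobc}=\frac{21B_{n}^{2}-3B_{n}B_{n+1}+3B_{2n}+3n}{4},\quad \sum_{i=1}^{n}C_{i}^{neobc}=15B_{n}^{2}-3B_{n}B_{n+1}+3B_{2n},$$ $$\sum_{i=1}^{n}R_{i}^{neobc}=\frac{9B_{n}^{2}-3B_{n}B_{n+1}+3B_{2n}-5n}{4},\quad \sum_{i=1}^{n}CR_{i}^{neobc}=3B_{n}^{2},$$ where $B_k$ are the balancing numbers.
   Context: Balancing numbers: $B_0=0$, $B_1=1$, $B_k=6B_{k-1}-B_{k-2}$. A positive integer $m$ is a neo balcobalancing number if there is a positive integer $r$ (its neo balcobalancer) such that $(1+2+\cdots+(m-1))+(1+2+\cdots+m)=2[(m-1)+m+(m+1)+(m+2)+\cdots+(m+r)]$; then $r=\frac{-2m-1+\sqrt{8m^2-12m+9}}{2}$ (equivalently, $m$ is a neo balcobalancing number iff $8m^2-12m+9$ is a perfect square). $B_n^{neobc}$ denotes the $n$-th neo balcobalancing number in increasing order ($n\ge1$), $R_n^{neobc}$ its neo balcobalancer, $C_n^{neobc}=\sqrt{8(B_n^{neobc})^2-12B_n^{neobc}+9}$ and $CR_n^{neobc}=\sqrt{2(R_n^{neobc})^2+5R_n^{neobc}+2}$. *)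

(* Defs.v *)
From HB Require Import structures.
From mathcomp Require Import all_boot all_order all_algebra.
From mathcomp Require Import zify.

Set Implicit Arguments.
Unset Strict Implicit.
Unset Printing Implicit Defensive.

Import Order.TTheory GRing.Theory Num.Theory.

Local Open Scope ring_scope.

Fixpoint balancing (n : nat) : int :=
  match n with
  | 0 => 0
  | k.+1 => match k with
            | 0 => 1
            | j.+1 => 6 * balancing k - balancing j
            end
  end.

Local Open Scope nat_scope.

Definition neo_balcobalancer (m r : nat) : bool :=
  [&& 0 < m, 0 < r &
    \sum_(1 <= i < m) i + \sum_(1 <= i < m.+1) i
      == 2 * \sum_(m.-1 <= i < (m + r).+1) i].

Definition neo_balcobalancing (m : nat) : Prop :=
  exists r, neo_balcobalancer m r.

Lemma double_sum_nat a k : 2 * \sum_(a <= i < a + k) i + k = k * (2 * a + k).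
Proof.
elim: k => [|k IH]; first by rewrite !addn0 big_geq.
rewrite (addnS a k) big_nat_recr ?leq_addr //=.
by move: (\sum_(_ <= _ < _) _) IH => x; lia.
Qed.

Lemma neo_balcobalancerE m r : neo_balcobalancer m r =
  [&& 0 < m, 0 < r & m ^ 2 == (r + 2) * (2 * m + r - 1)].
Proof.
rewrite /neo_balcobalancer; case: m => [|m] //=; case: r => [|r] //=.
have := double_sum_nat 1 m; have := double_sum_nat 1 m.+1.
have := double_sum_nat m r.+3.
have -> : (m.+1 + r.+1).+1 = m + r.+3 by lia.
rewrite !add1n.
move: (\sum_(_ <= _ < m + _) _) (\sum_(_ <= _ < m.+2) _)
  (\sum_(_ <= _ < m.+1) _) => x y z h1 h2 h3.
by apply/eqP/eqP; nia.
Qed.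

(* The defining relation forces r < m, so the search for r is bounded. *)
Lemma neo_balcobalancer_lt m r : neo_balcobalancer m r -> r < m.
Proof. by rewrite neo_balcobalancerE => /and3P[? ? /eqP ?]; nia. Qed.

Lemma neo_balcobalancer_uniq m r s :
  neo_balcobalancer m r -> neo_balcobalancer m s -> r = s.
Proof.
by rewrite !neo_balcobalancerE => /and3P[? ? /eqP ?] /and3P[? ? /eqP ?]; nia.
Qed.

Definition neo_balcobalancingb (m : nat) : bool :=
  [exists r : 'I_m, neo_balcobalancer m r].

Lemma neo_balcobalancingP m :
  reflect (neo_balcobalancing m) (neo_balcobalancingb m).
Proof.
apply: (iffP existsP) => [[r rP]|[r rP]]; first by exists r.
by exists (Ordinal (neo_balcobalancer_lt rP)).
Qed.

Definition neo_balcobalancer_of (m : nat) : nat :=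
  if [pick r : 'I_m | neo_balcobalancer m r] is Some r then r else 0.

Lemma neo_balcobalancer_ofP m :
  neo_balcobalancing m -> neo_balcobalancer m (neo_balcobalancer_of m).
Proof.
move=> [r rP]; rewrite /neo_balcobalancer_of.
by case: pickP => // /(_ (Ordinal (neo_balcobalancer_lt rP))); rewrite /= rP.
Qed.

Lemma neo_balcobalancer_step m r : neo_balcobalancer m r ->
  neo_balcobalancer (29 * m + 12 * r - 6) (12 * m + 5 * r - 4).
Proof.
rewrite !neo_balcobalancerE => /and3P[m0 r0 /eqP h].
by apply/and3P; split; [lia|lia|apply/eqP; nia].
Qed.

Lemma neo_balcobalancing_unbounded k :
  exists m, (k < m) && neo_balcobalancingb m.
Proof.
elim: k => [|k [m /andP[km /neo_balcobalancingP[r h]]]].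
  exists 6; apply/andP; split=> //; apply/neo_balcobalancingP; exists 1.
  by rewrite neo_balcobalancerE.
exists (29 * m + 12 * r - 6); apply/andP; split; first by lia.
by apply/neo_balcobalancingP; eexists; apply: neo_balcobalancer_step h.
Qed.

Definition next_neobc (k : nat) : nat :=
  ex_minn (neo_balcobalancing_unbounded k).

(* Indexing starts at 1; the value Bneobc 0 = 0 is junk. *)
Definition Bneobc (n : nat) : nat := iter n next_neobc 0.

Definition Rneobc (n : nat) : nat := neo_balcobalancer_of (Bneobc n).

Lemma Bneobc_increasing n : Bneobc n < Bneobc n.+1.
Proof. by rewrite /= /next_neobc; case: ex_minnP => m /andP[]. Qed.

Lemma Bneobc_spec n : 0 < n -> neo_balcobalancing (Bneobc n).
Proof.
case: n => // n _; rewrite /= /next_neobc.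
by case: ex_minnP => m /andP[_ /neo_balcobalancingP].
Qed.

Lemma Bneobc_onto m :
  neo_balcobalancing m -> exists2 n, 0 < n & Bneobc n = m.
Proof.
move=> mP; have m0 : 0 < m by case: mP => r /and3P[].
have hex : exists n, m <= Bneobc n.
  by exists m; elim: (m) => // k IH; apply: leq_ltn_trans IH (Bneobc_increasing k).
case: (ex_minnP hex) => -[|n] hn min_n; first by move: hn; rewrite leqNgt m0.
exists n.+1 => //; apply/eqP; rewrite eqn_leq hn andbT /= /next_neobc.
case: ex_minnP => p _; apply; apply/andP; split; last exact/neo_balcobalancingP.
by rewrite ltnNge; apply/negP => /min_n; rewrite ltnn.
Qed.

Lemma Rneobc_spec n : 0 < n -> neo_balcobalancer (Bneobc n) (Rneobc n).
Proof. by move=> n0; apply: neo_balcobalancer_ofP; apply: Bneobc_spec. Qed.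

Local Open Scope ring_scope.

Definition Cneobc (R : rcfType) (n : nat) : R :=
  Num.sqrt (8 * (Bneobc n)%:R ^+ 2 - 12 * (Bneobc n)%:R + 9).

Definition CRneobc (R : rcfType) (n : nat) : R :=
  Num.sqrt (2 * (Rneobc n)%:R ^+ 2 + 5 * (Rneobc n)%:R + 2).

(* Main.v *)
(** The solutions (m, r) of the defining equation form a single orbit, starting
    at (6, 1), of the Pell-type automorphism
    (m, r) |-> (29 m + 12 r - 6, 12 m + 5 r - 4): its inverse sends any solution
    with m > 6 to a smaller solution. Since the orbit is increasing, it lists the
    neo balcobalancing numbers in order. Along it, 4 m and 4 r are quadratic
    forms in consecutive balancing numbers b = B_k, c = B_{k+1}, and the
    invariant b^2 - 6 b c + c^2 = 1 makes both radicands perfect squares. The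
    sums then telescope, using B_{2n} = 2 B_n (B_{n+1} - 3 B_n). *)
Require Import Defs.
From HB Require Import structures.
From mathcomp Require Import all_boot all_order all_algebra.
From mathcomp Require Import zify ring lra.

Set Implicit Arguments.
Unset Strict Implicit.
Unset Printing Implicit Defensive.

Import Order.TTheory GRing.Theory Num.Theory.

Local Open Scope ring_scope.

(** * Descent on the defining equation *)

(** The linear part of the orbit map has determinant 1, so its inverse is integral and gives [m0]
    and [r0]. The bound on [m] excludes [(6, 1)], which is sent to [(0, 1)]. *)
Lemma neo_curve_descent (m r : int) :
  7 <= m -> 1 <= r -> m ^+ 2 = (r + 2) * (2 * m + r - 1) ->
  let m0 := 5 * m - 12 * r - 18 in let r0 := 29 * r - 12 * m + 44 in
  [/\ 1 <= m0, 1 <= r0 & m0 ^+ 2 = (r0 + 2) * (2 * m0 + r0 - 1)].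
Proof.
move=> m_ge7 r_ge1 mr m0 r0.
have m0_ge1 : 1 <= m0.
  rewrite leNgt; apply/negP => m0_lt1.
  (* Here [d = - m0]. Substituting [12 r = 5 m - 18 + d] into 144 times the equation bounds its
     right side below by [145 m^2 + 24 m - 180], which exceeds [144 m^2] once [m >= 7]. *)
  pose d := 12 * r - 5 * m + 18.
  have d_ge0 : 0 <= d by rewrite /d; move: m0_lt1; rewrite /m0; lia.
  have dm : 0 <= d * (m - 7) by apply: mulr_ge0 => //; lia.
  have mm : 0 <= (m - 7) * (m - 7) by rewrite -expr2 sqr_ge0.
  have dd : 0 <= d * d by rewrite -expr2 sqr_ge0.
  have e : 144 * m ^+ 2 = (5 * m + 6) * (29 * m - 30) + d * (34 * m - 24) + d * d.
    by rewrite mr /d; ring.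
  by move: (d) d_ge0 dm dd e => x *; lra.
have sum_ge1 : 1 <= 2 * m0 + 2 * r0 + 1.
  rewrite leNgt; apply/negP => sum_lt1.
  (* Here [e = - (m0 + r0) - 1]. Eliminating [17 r] from 289 times the equation and using [e <= 7 m]
     bounds its right side above by [287 m^2 - 21 m - 308], below [289 m^2]. *)
  pose e := 7 * m - 17 * r - 27.
  have e_ge0 : 0 <= e by move: sum_lt1; rewrite /e /m0 /r0; lia.
  have em : 0 <= e * (m - 1) by apply: mulr_ge0 => //; lia.
  have ee : 0 <= e * (7 * m - e) by apply: mulr_ge0 => //; rewrite /e; lia.
  have mm : 0 <= (m - 7) * (m - 7) by rewrite -expr2 sqr_ge0.
  have eq : 289 * m ^+ 2 =
      (7 * m + 7) * (41 * m - 44) - e * (48 * m - 37) + e * e.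
    by rewrite mr /e; ring.
  by move: (e) e_ge0 em ee eq => x *; lra.
have m0r0 : m0 ^+ 2 = (r0 + 2) * (2 * m0 + r0 - 1).
  by apply/eqP; rewrite -subr_eq0 /m0 /r0; apply/eqP; move: mr; lra.
split=> //; move: m0_ge1 sum_ge1 m0r0; move: (m0) (r0) => x y x_ge1 xy_ge1 xy.
have y_gtN2 : 0 < y + 2.
  rewrite ltNge; apply/negP => y_le.
  have : (y + 2) * (2 * x + y - 1) <= 0 by apply: mulr_le0_ge0 => //; lia.
  by rewrite -xy expr2; nia.
have [//|y_le0] := lerP 1 y.
(* The equation becomes [(x - 1)^2 + 1 = 0] for [y = -1] and [(x - 2)^2 = 2] for [y = 0]; neither
   has an integer root. *)
have [ey|ey] : y = -1 \/ y = 0 by lia.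
- by move: xy; rewrite ey expr2; nia.
have [?|?] := lerP x 3; last by move: xy; rewrite ey expr2; nia.
have [ex|[ex|ex]] : x = 1 \/ x = 2 \/ x = 3 by lia.
all: by move: xy; rewrite ey ex.
Qed.

Lemma neo_balcobalancer_descent (m r : nat) :
  neo_balcobalancer m r -> (6 < m)%N ->
  exists m0 r0 : nat, [/\ neo_balcobalancer m0 r0,
    m = (29 * m0 + 12 * r0 - 6)%N & r = (12 * m0 + 5 * r0 - 4)%N].
Proof.
rewrite neo_balcobalancerE => /and3P[_ r_gt0 /eqP mr] m_gt6.
have mrZ : m%:Z ^+ 2 = (r%:Z + 2) * (2 * m%:Z + r%:Z - 1).
  have -> : 2 * m%:Z + r%:Z - 1 = (2 * m + r - 1)%N%:Z by lia.
  by rewrite -(PoszD r 2) -PoszM -mr expr2 -PoszM.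
have [||m0_ge1 r0_ge1] := neo_curve_descent _ _ mrZ; [lia|lia|].
(* Positivity of both coordinates makes the truncated subtractions exact. *)
have [m0 e0] : exists m0 : nat, 5 * m%:Z - 12 * r%:Z - 18 = m0.
  by exists (5 * m - 12 * r - 18)%N; lia.
have [r0 e1] : exists r0 : nat, 29 * r%:Z - 12 * m%:Z + 44 = r0.
  by exists (29 * r + 44 - 12 * m)%N; lia.
rewrite e0 e1 => m0r0Z; exists m0, r0; split; [|lia|lia].
rewrite neo_balcobalancerE; apply/and3P; split; [lia|lia|].
have e2 : 2 * m0%:Z + r0%:Z - 1 = (2 * m0 + r0 - 1)%N%:Z by lia.
move: m0r0Z; rewrite e2 -(PoszD r0 2) -PoszM expr2 -PoszM => -[e].
by rewrite -mulnn e.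
Qed.

(** * The orbit of [(6, 1)] and the enumeration *)

Definition neo_orbit (k : nat) : nat * nat :=
  iter k (fun p => (29 * p.1 + 12 * p.2 - 6, 12 * p.1 + 5 * p.2 - 4)%N) (6, 1)%N.

Lemma neo_orbit_balcobalancer k :
  neo_balcobalancer (neo_orbit k).1 (neo_orbit k).2.
Proof.
elim: k => [|k IH]; first by rewrite neo_balcobalancerE.
exact: neo_balcobalancer_step IH.
Qed.

Lemma neo_orbit_increasing k : ((neo_orbit k).1 < (neo_orbit k.+1).1)%N.
Proof.
have := neo_orbit_balcobalancer k; rewrite neo_balcobalancerE => /and3P[? ? _].
by rewrite /=; lia.
Qed.

Lemma neo_orbit_mono : {mono (fun k => (neo_orbit k).1) : j k / (j < k)%N}.
Proof.
by apply: leqW_mono; apply: leq_mono; apply: homo_ltn neo_orbit_increasing;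
  exact: ltn_trans.
Qed.

Lemma neo_balcobalancer_orbit m r :
  neo_balcobalancer m r -> exists k, (m, r) = neo_orbit k.
Proof.
elim/ltn_ind: m r => m IH r mr.
have [m_le6|m_gt6] := leqP m 6.
  exists 0%N; have := neo_balcobalancer_lt mr.
  move: mr m_le6; rewrite neo_balcobalancerE {IH}.
  (* Since [r < m <= 6], finitely many pairs remain, and only [(6, 1)] satisfies the equation. *)
  by do 7![case: m => [|m]; first by do 6![case: r => [|r] //]].
have [m0 [r0 [m0r0 em er]]] := neo_balcobalancer_descent mr m_gt6.
have lt_m0m : (m0 < m)%N.
  by move: m0r0; rewrite neo_balcobalancerE => /and3P[? ? _]; lia.
by have [k ek] := IH _ lt_m0m _ m0r0; exists k.+1; rewrite /= -ek em er.
Qed.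

Lemma Bneobc_orbit k : Bneobc k.+1 = (neo_orbit k).1.
Proof.
elim: k => [|k IH].
  rewrite /= /next_neobc; case: ex_minnP => m /andP[_ /neo_balcobalancingP[r mr]].
  move/(_ 6%N) => /= le6; have [k ek] := neo_balcobalancer_orbit mr.
  apply/eqP; rewrite eqn_leq le6.
    rewrite -[m]/((m, r).1) ek -[6%N]/((neo_orbit 0).1) leqNgt.
    by rewrite neo_orbit_mono.
  by apply/neo_balcobalancingP; exists 1%N; exact: (neo_orbit_balcobalancer 0).
rewrite [LHS]/= -[next_neobc (iter _ _ _)]/(Bneobc k.+1) IH.
rewrite /next_neobc; case: ex_minnP => m /andP[km /neo_balcobalancingP[r mr]] minm.
have [j ej] := neo_balcobalancer_orbit mr.
apply/eqP; rewrite eqn_leq minm /=; last first.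
  rewrite neo_orbit_increasing; apply/neo_balcobalancingP.
  by exists (neo_orbit k.+1).2; exact: neo_orbit_balcobalancer.
(* The next number lies on the orbit at some index [j > k], so it is at least the entry of index
   [k.+1]. *)
move: km; rewrite -[m]/((m, r).1) ej neo_orbit_mono => kj.
by rewrite leqNgt -[X in (_ < X)%N]/((neo_orbit k.+1).1) neo_orbit_mono -leqNgt.
Qed.

Lemma Rneobc_orbit k : Rneobc k.+1 = (neo_orbit k).2.
Proof.
apply: neo_balcobalancer_uniq (Rneobc_spec (ltn0Sn k)) _.
rewrite Bneobc_orbit; exact: neo_orbit_balcobalancer.
Qed.

(** * Identities for balancing numbers *)

Lemma balancingSS n : balancing n.+2 = 6 * balancing n.+1 - balancing n.
Proof. by []. Qed.

Lemma balancing_invariant n :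
  balancing n ^+ 2 - 6 * balancing n * balancing n.+1 + balancing n.+1 ^+ 2 = 1.
Proof. by elim: n => // n IH; rewrite balancingSS -[RHS]IH; ring. Qed.

Lemma balancing_nondecreasing n : 0 <= balancing n <= balancing n.+1.
Proof. by elim: n => // n /andP[? ?]; rewrite balancingSS; lia. Qed.

Lemma balancingD m n : balancing (m + n).+1 =
  balancing m.+1 * balancing n.+1 - balancing m * balancing n.
Proof.
elim: m n => [|m IH] n; first by rewrite mul1r mul0r subr0.
by rewrite addSnnS IH !balancingSS; ring.
Qed.

Lemma balancing_double n :
  balancing (2 * n) = 2 * balancing n * (balancing n.+1 - 3 * balancing n).
Proof.
case: n => [|n]; first by rewrite mulr0 mul0r.
by rewrite mul2n -addnn addnS addSn -addnS balancingD balancingSS; ring.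
Qed.

(** Centred at its fixed point [(3/4, -5/4)], the orbit map is linear, and it acts on the two
    quadratic forms exactly as the shift [(b, c) |-> (c, 6 c - b)] does. *)
Lemma neo_orbit_balancing k :
  let b := balancing k in let c := balancing k.+1 in
  4 * (neo_orbit k).1%:Z = 21 * c ^+ 2 - 6 * b * c - 3 * b ^+ 2 + 3 /\
  4 * (neo_orbit k).2%:Z = 9 * c ^+ 2 - 6 * b * c + 9 * b ^+ 2 - 5.
Proof.
elim: k => [//|k [IH1 IH2]] b c.
have := neo_orbit_balcobalancer k; rewrite neo_balcobalancerE => /and3P[m0 r0 _].
have inv := balancing_invariant k.
have -> : (neo_orbit k.+1).1%:Z
    = 29 * (neo_orbit k).1%:Z + 12 * (neo_orbit k).2%:Z - 6 by rewrite /=; lia.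
have -> : (neo_orbit k.+1).2%:Z
    = 12 * (neo_orbit k).1%:Z + 5 * (neo_orbit k).2%:Z - 4 by rewrite /=; lia.
rewrite /b /c balancingSS.
by move: IH1 IH2 inv; move: (balancing k) (balancing k.+1) => x y; split; nia.
Qed.

(** * Closed forms over a real closed field *)

Section RealValues.
Variable R : rcfType.
Let B (k : nat) : R := (balancing k)%:~R.

Lemma Bneobc_balancing k : (Bneobc k.+1)%:R =
  (21 * B k.+1 ^+ 2 - 6 * B k * B k.+1 - 3 * B k ^+ 2 + 3) / 4.
Proof.
have [/(congr1 (intr : int -> R)) e _] := neo_orbit_balancing k.
move: e; rewrite -Bneobc_orbit /B !(rmorphD, rmorphB, rmorphM, rmorphXn) /=.
by lra.
Qed.

Lemma Rneobc_balancing k : (Rneobc k.+1)%:R =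
  (9 * B k.+1 ^+ 2 - 6 * B k * B k.+1 + 9 * B k ^+ 2 - 5) / 4.
Proof.
have [_ /(congr1 (intr : int -> R)) e] := neo_orbit_balancing k.
move: e; rewrite -Rneobc_orbit /B !(rmorphD, rmorphB, rmorphM, rmorphXn) /=.
by lra.
Qed.

Lemma balancing_invariantR k : B k ^+ 2 - 6 * B k * B k.+1 + B k.+1 ^+ 2 = 1.
Proof.
have /(congr1 (intr : int -> R)) := balancing_invariant k.
by rewrite /B !(rmorphD, rmorphB, rmorphM, rmorphXn) /=; lra.
Qed.

Lemma balancing_nondecreasingR k : 0 <= B k <= B k.+1.
Proof. by rewrite ler0z ler_int balancing_nondecreasing. Qed.

Lemma Cneobc_balancing k : Cneobc R k.+1 =
  15 * B k.+1 ^+ 2 - 6 * B k * B k.+1 + 3 * B k ^+ 2.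
Proof.
rewrite /Cneobc Bneobc_balancing.
have := balancing_invariantR k; move: (B k) (B k.+1) => b c inv.
have ge0 : 0 <= 15 * c ^+ 2 - 6 * b * c + 3 * b ^+ 2.
  by have := sqr_ge0 (b - c); have := sqr_ge0 c; nra.
rewrite -[RHS](ger0_norm ge0) -sqrtr_sqr; congr Num.sqrt.
(* With [4 m = Q + 3] the radicand is [(Q^2 + 9) / 2]. Multiplying 9 by the squared invariant, which
   is 1, gives a homogeneous quartic that is a perfect square. *)
transitivity (((21 * c ^+ 2 - 6 * b * c - 3 * b ^+ 2) ^+ 2
  + 9 * (b ^+ 2 - 6 * b * c + c ^+ 2) ^+ 2) / 2); last by field.
by rewrite inv; field.
Qed.

Lemma CRneobc_balancing k : CRneobc R k.+1 = 3 * B k.+1 ^+ 2 - 3 * B k ^+ 2.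
Proof.
rewrite /CRneobc Rneobc_balancing.
have /andP[] := balancing_nondecreasingR k; have := balancing_invariantR k.
move: (B k) (B k.+1) => b c inv b0 bc.
(* Monotonicity [0 <= b <= c] fixes the sign of the root. *)
have ge0 : 0 <= 3 * c ^+ 2 - 3 * b ^+ 2 by nra.
rewrite -[RHS](ger0_norm ge0) -sqrtr_sqr; congr Num.sqrt.
(* Likewise, [4 r = S - 5] turns the radicand into [(S^2 - 9) / 8]. *)
transitivity (((9 * c ^+ 2 - 6 * b * c + 9 * b ^+ 2) ^+ 2
  - 9 * (b ^+ 2 - 6 * b * c + c ^+ 2) ^+ 2) / 8); last by field.
by rewrite inv; field.
Qed.

Lemma balancingSSR k : B k.+2 = 6 * B k.+1 - B k.
Proof. by rewrite /B balancingSS rmorphB rmorphM. Qed.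

Lemma balancing_doubleR n : B (2 * n) = 2 * B n * (B n.+1 - 3 * B n).
Proof. by rewrite /B balancing_double !(rmorphM, rmorphB). Qed.

End RealValues.

Theorem theorem9p1 (R : rcfType) (n : nat) (n_ge1 : (1 <= n)%N) :
  let B (k : nat) : R := (balancing k)%:~R in
  [/\ \sum_(1 <= i < n.+1) (Bneobc i)%:R
        = (21 * B n ^+ 2 - 3 * B n * B n.+1 + 3 * B (2 * n)%N + 3 * n%:R) / 4,
      \sum_(1 <= i < n.+1) Cneobc R i
        = 15 * B n ^+ 2 - 3 * B n * B n.+1 + 3 * B (2 * n)%N,
      \sum_(1 <= i < n.+1) (Rneobc i)%:R
        = (9 * B n ^+ 2 - 3 * B n * B n.+1 + 3 * B (2 * n)%N - 5 * n%:R) / 4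
    & \sum_(1 <= i < n.+1) CRneobc R i = 3 * B n ^+ 2].
Proof.
(* Without [B (2 * n)], the right sides involve only [n], [B n] and [B n.+1], so each induction step
   is a polynomial identity once the recurrence removes [B n.+2]. *)
move=> B; rewrite /B balancing_doubleR {B}.
elim: n {n_ge1} => [|n [IHB IHC IHR IHCR]].
  by rewrite !big_geq //; split; rewrite /=; field.
rewrite !(@big_nat_recr _ _ _ n.+1) //= IHB IHC IHR IHCR.
rewrite Bneobc_balancing Cneobc_balancing Rneobc_balancing CRneobc_balancing.
rewrite balancingSSR -natr1.
by split; field.
Qed.
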